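(* Let $n,d\in\mathbb{N}$ be positive integers, let $\varepsilon>0$, and let $\|\cdot\|_p$ (with $1\le p\le\infty$) be the $p$-norm on $\mathbb{R}^d$. Let $F^{\mathrm{HK}}\subset(\mathbb{R}^d)^n$ and $F^{\mathrm{DW}}\subset(\mathbb{R}^d)^n$ be the sets of fixed points of the agent-based Hegselmann-Krause model and of the agent-based Deffuant-Weisbuch model, respectively, with $n$ agents, opinion space $\mathbb{R}^d$, bound of confidence $\varepsilon$ and norm $\|\cdot\|_p$. Then $$F^{\mathrm{HK}}=F^{\mathrm{DW}}=\{x\in(\mathbb{R}^d)^n \mid \forall i,j\in\{1,\dots,n\}:\ \|x^i-x^j\|_p>\varepsilon \text{ or } x^i=x^j\}.$$
   Context: An opinion profile is $x=(x^1,\dots,x^n)\in(\mathbb{R}^d)^n$, where $x^i\in\mathbb{R}^d$ is the opinion of agent $i$. Write $\|\cdot\|$ for the chosen norm on $\mathbb{R}^d$. Hegselmann-Krause (HK) model: for a profile $x$ and agent $i$ let $I_\varepsilon(i,x):=\{j\in\{1,\dots,n\} \mid \|x^i-x^j\|\le\varepsilon\}$. Let $A(x,\varepsilon)$ be the $n\times n$ matrix with $A_{ij}(x,\varepsilon)=1/\#I_\varepsilon(i,x)$ if $j\in I_\varepsilon(i,x)$ and $A_{ij}(x,\varepsilon)=0$ otherwise. The dynamics is $x(t+1)=A(x(t),\varepsilon)\,x(t)$, i.e. $x^i(t+1)=\frac{1}{\#I_\varepsilon(i,x(t))}\sum_{j\in I_\varepsilon(i,x(t))}x^j(t)$. A profile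 $x^\ast$ is a fixed point of the HK model if $A(x^\ast,\varepsilon)x^\ast=x^\ast$. Deffuant-Weisbuch (DW) model: in each time step two random agents $i,j$ are chosen and communicate: if $\|x^i(t)-x^j(t)\|\le\varepsilon$ then both set $x^i(t+1)=x^j(t+1)=\frac12(x^i(t)+x^j(t))$; otherwise both opinions stay unchanged. All other agents keep their opinions. A profile $x^\ast$ is a fixed point of the DW model if for all choices $i,j\in\{1,\dots,n\}$ the profile $x^\ast$ does not change if agents $i$ and $j$ communicate. *)

(* Defs.v *)
From mathcomp Require Import all_boot all_order all_algebra.
From mathcomp Require Import boolp classical_sets reals constructive_ereal exp.

Set Implicit Arguments.
Unset Strict Implicit.
Unset Printing Implicit Defensive.

Import Order.TTheory GRing.Theory Num.Theory.

Local Open Scope classical_set_scope.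
Local Open Scope ring_scope.

(* The p-norm is meant for 1 <= p; the value at p = -oo is irrelevant. *)
Definition pnorm (R : realType) (d : nat) (p : \bar R) (v : 'rV[R]_d) : R :=
  match p with
  | EFin q => (\sum_(k < d) `|v 0 k| `^ q) `^ q^-1
  | +oo%E => \big[Num.max/0]_(k < d) `|v 0 k|
  | -oo%E => 0
  end.

(* A profile (x^1, ..., x^n) in (R^d)^n is the n x d matrix whose i-th row is
   the opinion x^i, so that the matrix-vector product A(x, eps) x, in which A
   acts on the agent index, is A *m x. *)
Notation profile R n d := 'M[R]_(n, d) (only parsing).

Section Models.
Variables (R : realType) (n d : nat) (nrm : 'rV[R]_d -> R) (eps : R).
Implicit Types (x : profile R n d) (i j : 'I_n).

Definition confidence_set x i : {set 'I_n} :=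
  [set j | nrm (row i x - row j x) <= eps].

Definition hk_matrix x : 'M[R]_n :=
  \matrix_(i, j) if j \in confidence_set x i
                 then (#|confidence_set x i|%:R)^-1 else 0.

Definition hk_step x : profile R n d := hk_matrix x *m x.

Definition hk_fixed_points : set (profile R n d) := [set x | hk_step x = x].

Definition dw_step i j x : profile R n d :=
  if nrm (row i x - row j x) <= eps then
    \matrix_(k < n) (if (k == i) || (k == j)
                     then 2^-1 *: (row i x + row j x) else row k x)
  else x.

Definition dw_fixed_points : set (profile R n d) :=
  [set x | forall i j, dw_step i j x = x].

End Models.

(* Main.v *)
(* In a Hegselmann-Krause fixed point every x^i is the mean of its neighbours,
   i.e. each coordinate of x lies in the kernel of the Laplacian of the
   confidence graph.  That graph is undirected because the norm is even, so the
   Laplacian's quadratic form is half the sum of the squares (x^i_k - x^j_k)^2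
   over all ordered pairs of neighbours (i, j); hence neighbours agree.  Strict
   convexity of the norm, which fails at p = 1 and p = +oo, is not needed. *)

Require Import Defs.
From mathcomp Require Import all_boot all_order all_algebra.
From mathcomp Require Import ring lra.
From mathcomp Require Import boolp classical_sets reals constructive_ereal exp.

Set Implicit Arguments.
Unset Strict Implicit.
Unset Printing Implicit Defensive.

Import Order.TTheory GRing.Theory Num.Theory.

Local Open Scope classical_set_scope.
Local Open Scope ring_scope.

Lemma pnormN (R : realType) (d : nat) (p : \bar R) (v : 'rV[R]_d) :
  pnorm p (- v) = pnorm p v.
Proof.
by case: p => [q| |] //=; [congr (_ `^ _)|]; apply: eq_bigr => k _;
  rewrite mxE normrN.
Qed.

Lemma pnorm0 (R : realType) (d : nat) (p : \bar R) :
  (1 <= p)%E -> pnorm p (0 : 'rV[R]_d) = 0.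
Proof.
case: p => [q| |] //= hq.
  (* The bound [1 <= p] enters here: [powR] sends base and exponent both zero to 1, so the exponent
     must be nonzero. *)
  have q0 : q != 0 by rewrite gt_eqF // (lt_le_trans ltr01).
  rewrite big1 => [|k _]; first by rewrite powR0 // invr_eq0.
  by rewrite mxE normr0 powR0.
by elim/big_ind: _ => // [a b -> ->|k _]; rewrite ?maxxx // mxE normr0.
Qed.

Lemma laplacian_kernel (R : realDomainType) (n : nat) (w : rel 'I_n)
    (f : 'I_n -> R) :
  symmetric w -> (forall i, \sum_(j | w i j) (f i - f j) = 0) ->
  forall i j, w i j -> f i = f j.
Proof.
move=> wC f_harm.
have zero1 : \sum_i \sum_(j | w i j) f i * (f i - f j) = 0.
  by rewrite big1 // => i _; rewrite -mulr_sumr f_harm mulr0.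
(* Exchanging the two sums and reversing each edge by [wC] turns this into [zero1]. *)
have zero2 : \sum_i \sum_(j | w i j) f j * (f j - f i) = 0.
  rewrite (exchange_big_dep xpredT) //= -[RHS]zero1.
  by apply: eq_bigr => i _; apply: eq_bigl => j; rewrite wC.
(* Termwise, (a - b)^2 = a (a - b) + b (b - a), so the energy is the sum of [zero1] and [zero2]. *)
have energy0 : \sum_i \sum_(j | w i j) (f i - f j) ^+ 2 = 0.
  apply: etrans (etrans (f_equal2 +%R zero1 zero2) (addr0 0)).
  rewrite -big_split /=; apply: eq_bigr => i _.
  by rewrite -big_split /=; apply: eq_bigr => j _ /=; ring.
move=> i j wij.
have energy_i : \sum_(j | w i j) (f i - f j) ^+ 2 = 0.
  by apply: (psumr_eq0P _ energy0) => // a _; apply: sumr_ge0 => b _;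
    apply: sqr_ge0.
have /eqP : (f i - f j) ^+ 2 = 0.
  by apply: (psumr_eq0P _ energy_i) => // b _; apply: sqr_ge0.
by rewrite sqrf_eq0 subr_eq0 => /eqP.
Qed.

Section FixedPoints.
Variables (R : realType) (n d : nat) (nrm : 'rV[R]_d -> R) (eps : R).
Hypothesis nrmN : forall v, nrm (- v) = nrm v.
Hypothesis nrm0 : nrm 0 <= eps.
Implicit Types (x : profile R n d) (i j : 'I_n).

Definition separated_profiles : set (profile R n d) :=
  [set x | forall i j, eps < nrm (row i x - row j x) \/ row i x = row j x].

Lemma separatedP x :
  separated_profiles x <->
  forall i j, nrm (row i x - row j x) <= eps -> row i x = row j x.
Proof.
split=> sep i j; last by case: (leP (nrm _) eps) => [/sep|]; [right|left].
by case: (sep i j) => // /lt_geF ->.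
Qed.

Lemma hk_stepE x i k :
  hk_step nrm eps x i k =
  (#|confidence_set nrm eps x i|%:R)^-1 *
    \sum_(j in confidence_set nrm eps x i) x j k.
Proof.
rewrite mxE mulr_sumr [RHS]big_mkcond /=; apply: eq_bigr => j _.
by rewrite mxE; case: ifP => // _; rewrite mul0r.
Qed.

(** By [nrm0] each agent is in its own confidence set; hence the weights of [hk_matrix] are genuine
    inverses and can be cancelled. *)
Lemma card_confidence_set_neq0 x i :
  (#|confidence_set nrm eps x i|%:R : R) != 0.
Proof.
by rewrite pnatr_eq0 -lt0n; apply/card_gt0P; exists i; rewrite inE subrr.
Qed.

Lemma hk_fixed_points_separated :
  hk_fixed_points nrm eps = separated_profiles.
Proof.
apply/seteqP; split=> x /= => [x_fix|/separatedP x_sep].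
  apply/separatedP => i j x_ij; apply/rowP => k; rewrite !mxE.
  (* The graph is the confidence relation and the function is the [k]-th coordinate of the opinions;
     [nrmN] makes the graph undirected. *)
  apply: (@laplacian_kernel _ _
    (fun i j => nrm (row i x - row j x) <= eps) (x ^~ k)) => // [a b|a].
    by rewrite -nrmN opprB.
  have := hk_stepE x a k; rewrite x_fix => mean_a.
  (* With m neighbours, the Laplacian at [a] is m times [x a k] minus the neighbours' sum; replacing
     [x a k] by the mean cancels m. *)
  rewrite sumrB sumr_const -mulr_natl mean_a.
  rewrite (eq_card (B := confidence_set nrm eps x a)) => [|b]; last first.
    by rewrite !inE.
  rewrite mulVKf ?card_confidence_set_neq0 //.
  by apply/eqP; rewrite subr_eq0; apply/eqP/eq_bigl => b; rewrite inE.
apply/matrixP => i k; rewrite hk_stepE (eq_bigr (fun=> x i k)).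
  by rewrite sumr_const -(mulr_natl (x i k)) mulKf ?card_confidence_set_neq0.
by move=> j; rewrite inE => /x_sep /rowP /(_ k); rewrite !mxE.
Qed.

Lemma dw_fixed_points_separated :
  dw_fixed_points nrm eps = separated_profiles.
Proof.
apply/seteqP; split=> x /= => [x_fix|/separatedP x_sep].
  apply/separatedP => i j x_ij; apply/rowP => k; rewrite !mxE.
  have /matrixP/(_ i k) := x_fix i j.
  (* Agent [i] moves to the midpoint, and a = (a + b) / 2 forces a = b. *)
  by rewrite /dw_step x_ij !mxE eqxx /= !mxE; lra.
move=> i j; rewrite /dw_step; case: ifP => // /x_sep eq_ij.
apply/row_matrixP => k; rewrite rowK.
have mean_j : 2^-1 *: (row i x + row j x) = row j x.
  by apply/rowP => l; rewrite eq_ij !mxE; lra.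
by case: ifP => // /orP[] /eqP ->; rewrite mean_j.
Qed.

End FixedPoints.

Theorem proposition2 (R : realType) (n d : nat) (hn : (0 < n)%N) (hd : (0 < d)%N)
    (eps : R) (heps : 0 < eps) (p : \bar R) (hp : (1 <= p)%E) :
  hk_fixed_points (n := n) (pnorm (d := d) p) eps =
    dw_fixed_points (n := n) (pnorm (d := d) p) eps
  /\
  dw_fixed_points (n := n) (pnorm (d := d) p) eps =
    [set x : profile R n d | forall i j : 'I_n,
       eps < pnorm p (row i x - row j x) \/ row i x = row j x].
Proof.
have nrm0 : pnorm p (0 : 'rV[R]_d) <= eps by rewrite pnorm0 // ltW.
have nrmN := @pnormN R d p.
by rewrite hk_fixed_points_separated // dw_fixed_points_separated.
Qed.
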